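(* Let $G$ and $H$ be finite simple connected graphs. Then (i) $M^{ev}(G+_{Sd}H) = n(G)M^{ev}(H) + n(H)F(G) + 8m(H)M_1(G) + 4n(H)M_1(G) + 10m(G)M_1(H) + 16m(G)m(H) + 8n(H)m(G) - 24\eta(H)m(G)$; (ii) $M^{ev}(G+_{ESTo}H) = n(H)M^{ev}(L(G)) + n(G)M^{ev}(H) + 8n(H)M_1(L(G)) + 4m(H)M_1(G) + 10m(G)M_1(H) + 33n(H)m(L(G)) + 16m(L(G))m(H) + 24m(G)m(H) + 18m(G)n(H) - 24m(G)\eta(H) - 18n(H)\eta(L(G))$.
   Context: For a finite simple graph $K$: $V(K)$ and $E(K)$ are its vertex and edge sets, $n(K)=|V(K)|$, $m(K)=|E(K)|$, $d_K(x)$ is the degree of the vertex $x$, $N[x]$ is the closed neighbourhood of $x$, and $\eta(K)$ is the total number of triangles in $K$. For an edge $e=xy$ of $K$, the edge-vertex degree is $deg^{ev}_K(e)=|N[x]\cup N[y]|$; equivalently $deg^{ev}_K(e)=d_K(x)+d_K(y)-\eta_K(e)$, where $\eta_K(e)$ is the number of triangles of $K$ containing $e$. The $ev$-degree Zagreb index is $M^{ev}(K)=\sum_{e\in E(K)} deg^{ev}_K(e)^2$. The first Zagreb index is $M_1(K)=\sum_{x\in V(K)} d_K(x)^2$ and the forgotten index is $F(K)=\sum_{x\in V(K)} d_K(x)^3$. The line graph $L(G)$ has vertex set $E(G)$, two vertices being adjacent iff the corresponding edges of $G$ are adjacent (distinct and sharing an endpoint). If $E(G)=\emptyset$, all the quantities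 for $L(G)$ are $0$. The subdivision graph $Sd(G)$ has vertex set $V(G)\sqcup E(G)$, with $x\in V(G)$ adjacent to $y\in E(G)$ iff $y$ is incident to $x$ in $G$, and no other adjacencies. The edge-semitotal graph $ESTo(G)$ has vertex set $V(G)\sqcup E(G)$, where two elements of $E(G)$ are adjacent iff they are adjacent edges of $G$, an element $x\in V(G)$ is adjacent to $y\in E(G)$ iff $y$ is incident to $x$, and there are no other adjacencies. For $\Phi\in\{Sd, ESTo\}$, the graph $G+_{\Phi}H$ has vertex set $(V(G)\cup E(G))\times V(H)$ (with $V(G)$ and $E(G)$ regarded as disjoint), and $(x,y)$ is adjacent to $(x',y')$ iff either $x=x'\in V(G)$ and $yy'\in E(H)$, or $y=y'$ and $xx'\in E(\Phi(G))$. *)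

(* Defs.v *)
From mathcomp Require Import all_boot all_order all_algebra.

Set Implicit Arguments.
Unset Strict Implicit.
Unset Printing Implicit Defensive.

Record sgraph := SGraph {
  vert :> finType;
  adj : rel vert;
  adj_sym : symmetric adj;
  adj_irrefl : irreflexive adj
}.

Definition connected_graph (K : sgraph) : Prop :=
  0 < #|K| /\ forall x y : K, connect (@adj K) x y.

Definition edges (K : sgraph) : {set {set K}} :=
  [set e | [exists x : K, exists y : K, adj x y && (e == [set x; y])]].

(* E(K) as a type, so that edges can serve as vertices. *)
Definition edge (K : sgraph) : finType := {e : {set K} | e \in edges K}.

Section Indices.
Variable K : sgraph.

Definition nvert : nat := #|K|.

Definition nedge : nat := #|edges K|.

Definition deg (x : K) : nat := #|[set y : K | adj x y]|.

Definition cl_nbhd (x : K) : {set K} := [set y : K | (y == x) || adj x y].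

(* Triangles are counted as vertex sets, hence without orientation. *)
Definition triangle (t : {set K}) : bool :=
  (#|t| == 3) && [forall x in t, forall y in t, (x != y) ==> adj x y].

Definition ntriangles : nat := #|[set t : {set K} | triangle t]|.

(* For e = {x, y} this is |N[x] :|: N[y]|; see evdeg_set2. *)
Definition evdeg (e : {set K}) : nat := #|\bigcup_(x in e) cl_nbhd x|.

Definition evZagreb : nat := \sum_(e in edges K) evdeg e ^ 2.

Definition firstZagreb : nat := \sum_(x : K) deg x ^ 2.

Definition forgotten : nat := \sum_(x : K) deg x ^ 3.

Lemma evdeg_set2 (x y : K) :
  evdeg [set x; y] = #|cl_nbhd x :|: cl_nbhd y|.
Proof. by rewrite /evdeg bigcup_setU !big_set1. Qed.

End Indices.

Section LineGraph.
Variable G : sgraph.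

Definition line_adj : rel (edge G) :=
  fun e f => (e != f) && (val e :&: val f != set0).

Lemma line_adj_sym : symmetric line_adj.
Proof. by move=> e f; rewrite /line_adj eq_sym setIC. Qed.

Lemma line_adj_irrefl : irreflexive line_adj.
Proof. by move=> e; rewrite /line_adj eqxx. Qed.

Definition line_graph : sgraph := SGraph line_adj_sym line_adj_irrefl.

End LineGraph.

Inductive transform := Sd | ESTo.

Section Transform.
Variable G : sgraph.

Definition Sd_adj : rel (G + edge G) := fun u v =>
  match u, v with
  | inl x, inr e | inr e, inl x => x \in val e
  | inl _, inl _ | inr _, inr _ => false
  end.

Definition ESTo_adj : rel (G + edge G) := fun u v =>
  match u, v with
  | inl x, inr e | inr e, inl x => x \in val e
  | inr e, inr f => line_adj e f
  | inl _, inl _ => false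
  end.

Definition transform_adj (Phi : transform) : rel (G + edge G) :=
  match Phi with Sd => Sd_adj | ESTo => ESTo_adj end.

Lemma transform_adj_sym Phi : symmetric (transform_adj Phi).
Proof. by case: Phi => [] [x|e] [y|f] //=; apply: line_adj_sym. Qed.

Lemma transform_adj_irrefl Phi : irreflexive (transform_adj Phi).
Proof. by case: Phi => [] [x|e] //=; apply: line_adj_irrefl. Qed.

Definition transform_graph (Phi : transform) : sgraph :=
  SGraph (@transform_adj_sym Phi) (@transform_adj_irrefl Phi).

End Transform.

Section PhiSum.
Variables (Phi : transform) (G H : sgraph).

Definition phi_sum_adj : rel (transform_graph G Phi * H) := fun p q =>
  [exists x : G, [&& p.1 == inl x, q.1 == inl x & adj p.2 q.2]]
  || ((p.2 == q.2) && adj p.1 q.1).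

Lemma phi_sum_adj_sym : symmetric phi_sum_adj.
Proof.
move=> p q; rewrite /phi_sum_adj [p.2 == _]eq_sym [adj p.1 _]adj_sym.
congr (_ || _); apply: eq_existsb => x.
by rewrite [adj p.2 _]adj_sym andbCA.
Qed.

Lemma phi_sum_adj_irrefl : irreflexive phi_sum_adj.
Proof.
move=> p; rewrite /phi_sum_adj !adj_irrefl andbF orbF.
by apply/existsP=> -[x]; rewrite !andbF.
Qed.

Definition phi_sum : sgraph := SGraph phi_sum_adj_sym phi_sum_adj_irrefl.

End PhiSum.

(* Main.v *)
Require Import Defs.
From mathcomp Require Import all_boot all_order all_algebra.
From mathcomp Require Import zify ring.

Set Implicit Arguments.
Unset Strict Implicit.
Unset Printing Implicit Defensive.

(** The edges of G +_Phi H fall into three families: a copy of an edge yz of H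
    above a vertex x of G; an incidence (x, e) of G at a height y in H; and, for
    ESTo only, an edge of the line graph L(G) at a height y.  In each family the
    ev-degree is a sum of a quantity depending on G and one depending on H:
    - above x, the edge yz has ev-degree 2 d(x) + deg^ev(yz), because the d(x)
      edges at x give distinct neighbours at the heights y and z
      ([evdeg_vertex_vertex]);
    - the incidence (x, e) at height y has ev-degree d(y) + 2 + d(x) for Sd and
      d(y) + 2 + (d_L(e) + 1) for ESTo ([evdeg_vertex_edge]); in the second case
      the edges at x already lie in the closed neighbourhood of e in L(G);
    - the edge ef of L(G) at any height has ev-degree deg^ev_L(ef) + 3, since two
      adjacent edges of G cover three vertices ([evdeg_edge_edge]).

    The squares of these sums are expanded over product index sets with
    [sum_sqrD].  What remains are first and second moments, which the handshake
    lemma, the two ends of each edge ([sum_incidences_edge]), and the identity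
    sum_e deg^ev(e) = M_1 - 3 eta ([sum_evdeg]) turn into the stated indices.
    The last identity is the only source of triangle counts.

    Sums over edges are handled as sums over ordered adjacent pairs (darts), that
    is, doubled: sums over pairs split along the sum and product types of which
    the vertex set of G +_Phi H is made.  The subtracted terms are kept on the
    other side, so that all counting takes place in nat. *)

(** * Sums over product index sets *)

Lemma sum_sqrD (I J : finType) (P : pred I) (Q : pred J)
    (a : I -> nat) (b : J -> nat) :
  \sum_(i | P i) \sum_(j | Q j) (a i + b j) ^ 2
  = (\sum_(j | Q j) 1) * (\sum_(i | P i) a i ^ 2)
    + 2 * (\sum_(i | P i) a i) * (\sum_(j | Q j) b j)
    + (\sum_(i | P i) 1) * (\sum_(j | Q j) b j ^ 2).
Proof.
rewrite -mulnA !big_distrlr /= [X in X + _ + _]exchange_big /=.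
rewrite big_distrr -!big_split; apply: eq_bigr => i _ /=.
rewrite big_distrr -!big_split; apply: eq_bigr => j _ /=.
ring.
Qed.

Lemma sum_set_const (T : finType) (A : {set T}) (n : nat) (F : T -> nat) :
  {in A, forall x, F x = n} -> \sum_(x in A) F x = #|A| * n.
Proof. by move=> FE; rewrite (eq_bigr _ FE) sum_nat_const. Qed.

(** * Darts, the handshake lemma and triangles *)

Section Darts.
Variable K : sgraph.
Implicit Types x y z : K.

Lemma edgesP e :
  reflect (exists x y : K, adj x y /\ e = [set x; y]) (e \in edges K).
Proof.
rewrite inE; apply: (iffP existsP) => [[x /existsP[y /andP[xy /eqP ->]]]|].
  by exists x, y.
by case=> x [y [xy ->]]; exists x; apply/existsP; exists y; rewrite xy eqxx.
Qed.

Lemma adj_neq x y : adj x y -> x != y.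
Proof. by apply: contraTneq => ->; rewrite adj_irrefl. Qed.

Lemma card_edge e : e \in edges K -> #|e| = 2.
Proof. by case/edgesP => x [y [/adj_neq xy ->]]; rewrite cards2 xy. Qed.

Lemma sum_darts (F : {set K} -> nat) :
  \sum_(p : K * K | adj p.1 p.2) F [set p.1; p.2]
  = 2 * \sum_(e in edges K) F e.
Proof.
rewrite (partition_big (fun p : K * K => [set p.1; p.2]) (mem (edges K))) /=;
  last by move=> p xy; apply/edgesP; exists p.1, p.2.
rewrite big_distrr /=; apply: eq_bigr => e /edgesP[x [y [xy ->]]].
have neq_xy := adj_neq xy.
rewrite (eq_bigr (fun=> F [set x; y])) => [|p /andP[_ /eqP -> //]].
rewrite sum_nat_const; congr (_ * _).
rewrite (eq_card (B := pred2 (x, y) (y, x))) => [|[u v]].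
  by rewrite card2 xpair_eqE negb_and neq_xy.
rewrite [RHS]inE !xpair_eqE [LHS]unfold_in /=.
apply/andP/orP => [[uv /eqP E]|[/andP[/eqP-> /eqP->]|/andP[/eqP-> /eqP->]]].
- have := adj_neq uv.
  have : u \in [set x; y] by rewrite -E !inE eqxx.
  have : v \in [set x; y] by rewrite -E !inE eqxx orbT.
  rewrite !inE => /orP[]/eqP-> /orP[]/eqP->; rewrite ?eqxx //; first by right.
  by left.
- by [].
- by rewrite adj_sym setUC.
Qed.

Lemma double_evZagreb :
  \sum_(p : K * K | adj p.1 p.2) evdeg [set p.1; p.2] ^ 2 = 2 * evZagreb K.
Proof. exact: (sum_darts (fun e => evdeg e ^ 2)). Qed.

Lemma sum_darts_tail (F : K -> nat) :
  \sum_(p : K * K | adj p.1 p.2) F p.1 = \sum_(x : K) deg x * F x.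
Proof.
rewrite -(pair_big_dep xpredT (@adj K) (fun x _ => F x)) /=.
apply: eq_bigr => x _; rewrite sum_nat_const; congr (_ * _).
by apply: eq_card => y; rewrite inE.
Qed.

Lemma card_darts : \sum_(p : K * K | adj p.1 p.2) 1 = 2 * nedge K.
Proof. by rewrite (sum_darts (fun=> 1)) sum1_card. Qed.

Lemma handshake : \sum_(x : K) deg x = 2 * nedge K.
Proof.
rewrite -card_darts (sum_darts_tail (fun=> 1)).
by apply: eq_bigr => x _; rewrite muln1.
Qed.

(** Closed neighbourhoods may be replaced by open ones here, since adjacent x and
    y belong to each other's neighbourhood; the rest is inclusion-exclusion. *)
Lemma evdeg_common x y : adj x y ->
  evdeg [set x; y] + #|[set z | adj x z && adj y z]| = deg x + deg y.
Proof.
move=> xy; rewrite evdeg_set2 /deg -[RHS]cardsUI; congr (#|pred_of_set _| + _).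
  apply/setP=> z; rewrite !inE; case: eqP => [->|_] /=.
    by rewrite [adj y x]adj_sym xy orbT.
  by case: eqP => [->|_]; rewrite ?xy ?orbT.
by apply: eq_card => z; rewrite !inE.
Qed.

(** Each triangle is the vertex set of 3! ordered triples of mutually adjacent
    vertices. *)
Lemma sum_common :
  \sum_(p : K * K | adj p.1 p.2) #|[set z | adj p.1 z && adj p.2 z]|
  = 6 * ntriangles K.
Proof.
pose tri x y z := [&& adj x y, adj x z & adj y z].
pose mk (p : K * K * K) := p.1.1 |: [set p.1.2; p.2].
transitivity (\sum_(p : K * K * K | tri p.1.1 p.1.2 p.2) 1).
  rewrite -(pair_big_dep (fun p => adj p.1 p.2)
     (fun p z => adj p.1 z && adj p.2 z) (fun _ _ => 1)) /=.
  by apply: eq_bigr => p _; rewrite sum1_card; apply: eq_card => z; rewrite inE.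
rewrite (partition_big mk (@triangle K)) /=; last first.
  case=> [[x y] z] /and3P[/= xy xz yz]; rewrite /triangle /mk /=.
  rewrite cardsU1 cards2 !inE negb_or !adj_neq //=.
  apply/forall_inP => u; rewrite !inE => uE; apply/forall_inP => v.
  rewrite !inE => vE; apply/implyP.
  by case/or3P: uE => /eqP->; case/or3P: vE => /eqP->;
     rewrite ?eqxx // => _; rewrite // adj_sym.
rewrite (eq_bigr (fun=> 6)) => [|t tT].
  by rewrite sum_nat_const mulnC /ntriangles cardsE.
have t3 : #|t| = 3 by case/andP: tT => /eqP.
(* The triples spanning t are its injective enumerations. *)
transitivity (\sum_(x in t) \sum_(y in t :\ x) \sum_(z in t :\ x :\ y) 1).
  rewrite pair_big_dep /= pair_big_dep /=.
  apply: eq_bigl => [[[x y] z]] /=.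
  rewrite /tri /mk /=; apply/andP/idP => [[/and3P[xy xz yz] /eqP <-]|].
    by rewrite !inE !eqxx !orbT /= ![_ == x]eq_sym [z == y]eq_sym !adj_neq.
  rewrite !inE => /andP[/and3P[xt yx yt] /and3P[zy zx zt]].
  case/andP: (tT) => _ /forall_inP ht.
  have adjt u v : u \in t -> v \in t -> u != v -> adj u v.
    by move=> ut vt; move/forall_inP: (ht u ut) => /(_ v vt)/implyP.
  split; first by rewrite !adjt // eq_sym.
  rewrite eqEcard t3 cardsU1 cards2 !inE ![x == _]eq_sym [y == z]eq_sym.
  rewrite (negbTE yx) (negbTE zx) zy /= andbT.
  by apply/subsetP => u; rewrite !inE => /or3P[]/eqP->.
rewrite (@sum_set_const _ _ 2) ?t3 // => x xt.
have t2 : #|t :\ x| = 2 by have := cardsD1 x t; rewrite t3 xt => -[].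
rewrite (@sum_set_const _ _ 1) ?t2 // => y yt.
by rewrite sum1_card; have := cardsD1 y (t :\ x); rewrite t2 yt => -[].
Qed.

(** Doubled form of sum_e deg^ev(e) + 3 eta = M_1: over all darts, each of the
    endpoint degrees d(x), d(y) sums to M_1. *)
Lemma sum_evdeg :
  \sum_(p : K * K | adj p.1 p.2) evdeg [set p.1; p.2] + 6 * ntriangles K
  = 2 * firstZagreb K.
Proof.
rewrite -sum_common -big_split /=.
rewrite (eq_bigr (fun p : K * K => deg p.1 + deg p.2)); last first.
  by move=> p; apply: evdeg_common.
rewrite big_split /= [X in _ + X](_ : _ = \sum_(p : K * K | adj p.1 p.2) deg p.1).
  by rewrite sum_darts_tail addnn mul2n.
rewrite -(pair_big_dep xpredT (@adj K) (fun _ y => deg y)) /=.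
rewrite -(pair_big_dep xpredT (@adj K) (fun x _ => deg x)) /=.
rewrite (exchange_big_dep xpredT) //=; apply: eq_bigr => y _.
by apply: eq_bigl => x; rewrite adj_sym.
Qed.

End Darts.

(** * Vertex-edge incidences and the line graph *)

Section Incidences.
Variable G : sgraph.
Implicit Types (x : G) (e f : edge G).

Lemma card_val_edge e : #|val e| = 2.
Proof. exact/card_edge/valP. Qed.

Lemma nvert_line_graph : #|line_graph G| = nedge G.
Proof. by rewrite card_sig; apply: eq_card => e; rewrite inE. Qed.

(** The neighbours y of x correspond to the edges xy. *)
Lemma card_edges_at x : #|[set e : edge G | x \in val e]| = deg x.
Proof.
rewrite -(card_imset _ val_inj) /deg.
have inj : {in [set y | adj x y] &, injective (fun y => [set x; y])}.
  move=> y z; rewrite !inE => /adj_neq; rewrite eq_sym => yx _ /setP/(_ y).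
  by rewrite !inE eqxx orbT (negbTE yx) => /esym/eqP.
rewrite -(card_in_imset inj); apply: eq_card => s.
apply/imsetP/imsetP => [[[e /= eE]]|[y]]; rewrite inE /=.
  move=> xe ->; case/edgesP: (eE) xe => u [v [uv ->]].
  rewrite !inE => /orP[]/eqP->; first by exists v; rewrite ?inE.
  by exists u; rewrite ?inE 1?adj_sym // setUC.
move=> xy ->; have eE : [set x; y] \in edges G by apply/edgesP; exists x, y.
by exists (exist (fun s => s \in edges G) _ eE); rewrite ?inE ?eqxx.
Qed.

Lemma sum_incidences_vertex (F : G -> nat) :
  \sum_(i : G * edge G | i.1 \in val i.2) F i.1 = \sum_x deg x * F x.
Proof.
rewrite -(pair_big_dep xpredT (fun x e => x \in val e) (fun x _ => F x)) /=.
apply: eq_bigr => x _; rewrite sum_nat_const -card_edges_at; congr (_ * _).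
by apply: eq_card => e; rewrite inE.
Qed.

Lemma sum_incidences_edge (F : line_graph G -> nat) :
  \sum_(i : G * edge G | i.1 \in val i.2) F i.2 = 2 * \sum_(e : line_graph G) F e.
Proof.
rewrite -(pair_big_dep xpredT (fun x e => x \in val e) (fun _ e => F e)) /=.
rewrite (exchange_big_dep xpredT) //= big_distrr /=; apply: eq_bigr => e _.
by rewrite sum_nat_const card_val_edge.
Qed.

Lemma card_incidences :
  \sum_(i : G * edge G | i.1 \in val i.2) 1 = 2 * nedge G.
Proof.
by rewrite (sum_incidences_edge (fun=> 1)) sum1_card nvert_line_graph.
Qed.

(** Two distinct 2-element sets that meet share exactly one vertex. *)
Lemma card_adjacent_edges e f : line_adj e f -> #|val e :|: val f| = 3.
Proof.
case/andP=> neq_ef; rewrite -card_gt0 => ef.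
have := cardsUI (val e) (val f); rewrite !card_val_edge.
suff : #|val e :&: val f| < 2 by lia.
have := subset_leq_card (subsetIl (val e) (val f)).
rewrite card_val_edge ltn_neqAle => ->; rewrite andbT.
apply: contra neq_ef => /eqP I2; rewrite -val_eqE; apply/eqP.
have /eqP Ie : val e :&: val f == val e by rewrite eqEcard subsetIl card_val_edge I2.
have /eqP If : val e :&: val f == val f by rewrite eqEcard subsetIr card_val_edge I2.
by rewrite -Ie [LHS]If.
Qed.

End Incidences.

(** * Neighbourhoods in G +_Phi H *)

(** Used to split a vertex set of G +_Phi H into its parts over V(G) and over
    E(G). *)
Lemma card_sumX (A B C : finType) (S : {set (A + B) * C}) :
  #|S| = #|[set p : A * C | (inl p.1, p.2) \in S]|
         + #|[set p : B * C | (inr p.1, p.2) \in S]|.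
Proof.
rewrite -!sum1_card.
transitivity (\sum_u \sum_(c | (u, c) \in S) 1).
  by rewrite pair_big_dep /=; apply: eq_bigl => -[].
rewrite big_sumType /=; congr (_ + _); rewrite pair_big_dep /=;
  by apply: eq_bigl => p; rewrite inE.
Qed.

Lemma card_cl_nbhd (K : sgraph) (x : K) : #|cl_nbhd x| = deg x + 1.
Proof.
have -> : cl_nbhd x = x |: [set y | adj x y] by apply/setP=> y; rewrite !inE.
by rewrite cardsU1 inE adj_irrefl addnC.
Qed.

Section PhiSumEdges.
Variables (Phi : transform) (G H : sgraph).
Local Notation GH := (phi_sum Phi G H).
Local Notation at_vertex x y := ((inl x, y) : GH).
Local Notation at_edge e y := ((inr e, y) : GH).
Implicit Types (x : G) (e f : edge G) (y z : H).

Lemma adj_vertex_vertex x x' y z :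
  @phi_sum_adj Phi G H (inl x, y) (inl x', z) = (x == x') && adj y z.
Proof.
rewrite /phi_sum_adj /= (_ : transform_adj Phi _ _ = false); last by case: (Phi).
rewrite andbF orbF; apply/existsP/andP => [[u]|[/eqP-> yz]].
  by case/and3P => /eqP[->] /eqP[->].
by exists x'; rewrite !eqxx.
Qed.

Lemma adj_vertex_edge x e y z :
  @phi_sum_adj Phi G H (inl x, y) (inr e, z) = (y == z) && (x \in val e).
Proof.
rewrite /phi_sum_adj /= (_ : transform_adj Phi _ _ = (x \in val e));
  last by case: (Phi).
rewrite orbC; case: (_ && _) => //=; apply/existsP => -[u].
by rewrite andbF.
Qed.

Lemma adj_edge_vertex x e y z :
  @phi_sum_adj Phi G H (inr e, y) (inl x, z) = (y == z) && (x \in val e).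
Proof. by rewrite phi_sum_adj_sym adj_vertex_edge eq_sym. Qed.

Lemma adj_edge_edge e f y z :
  @phi_sum_adj Phi G H (inr e, y) (inr f, z)
  = (y == z) && transform_adj Phi (inr e) (inr f).
Proof.
rewrite /phi_sum_adj /= orbC; case: (_ && _) => //=.
by apply/existsP => -[u].
Qed.

Let inlE x x' : (inl x == inl x' :> transform_graph G Phi) = (x == x').
Proof. by []. Qed.
Let inrE e f : (inr e == inr f :> transform_graph G Phi) = (e == f).
Proof. by []. Qed.
Definition sum_adjE := (adj_vertex_vertex, adj_vertex_edge,
  adj_edge_vertex, adj_edge_edge, xpair_eqE, inlE, inrE).

Lemma evdeg_vertex_vertex x y z : adj y z ->
  evdeg [set at_vertex x y; at_vertex x z] = 2 * deg x + evdeg [set y; z].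
Proof.
move=> yz; rewrite [LHS]evdeg_set2 card_sumX addnC; congr (_ + _).
  rewrite -card_edges_at.
  have <- : #|[set y; z]| = 2 by rewrite cards2 (adj_neq yz).
  rewrite mulnC -cardsX; apply: eq_card => -[e u].
  rewrite !inE /= !sum_adjE ![_ == u]eq_sym /=.
  by case: (x \in val e); rewrite ?andbF // !andbT.
rewrite evdeg_set2 -[RHS]mul1n -(cards1 x) -cardsX.
apply: eq_card => -[x' u]; rewrite !inE /= !sum_adjE /= (eq_sym x).
by case: (x' == x).
Qed.

(** The part over V(G) of the closed neighbourhood of the edge (x, y)(e, y): the
    H-neighbours of y above x and the two ends of e at height y. *)
Lemma card_star_vertices x e y : x \in val e ->
  #|[set p : G * H | (p.1 == x) && adj y p.2] :|: setX (val e) [set y]|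
  = deg y + 2.
Proof.
move=> xe; rewrite cardsU (_ : _ :&: _ = set0); last first.
  apply/setP=> -[x' u]; rewrite !inE /=.
  case: (u =P y) => [->|_]; first by rewrite adj_irrefl andbF.
  by rewrite !andbF.
rewrite cards0 subn0 cardsX cards1 muln1 card_val_edge; congr (_ + 2).
rewrite -[RHS]mul1n -(cards1 x) -cardsX; apply: eq_card => -[x' u].
by rewrite !inE.
Qed.

Lemma evdeg_vertex_edge x e y : x \in val e ->
  evdeg [set at_vertex x y; at_edge e y]
  = deg y + 2 + match Phi with Sd => deg x
                | ESTo => deg (e : line_graph G) + 1 end.
Proof.
move=> /= xe; rewrite [LHS]evdeg_set2 card_sumX -(card_star_vertices y xe).
congr (_ + _).
  apply: eq_card => -[x' u]; rewrite !inE /= !sum_adjE /= (eq_sym x) (eq_sym y).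
  case: (x' =P x) => [->|_] /=; last by rewrite andbC.
  rewrite (_ : (x \in sval e) = true) //.
  by case: (u == y); rewrite /= ?orbF ?orbT.
transitivity #|setX match Phi with
    | Sd => [set f : edge G | x \in val f]
    | ESTo => cl_nbhd (e : line_graph G) end [set y]|.
  apply: eq_card => -[f u]; rewrite !inE /= !sum_adjE /= (eq_sym y).
  case: (u == y); rewrite /= ?andbF // !andbT.
  case: (Phi) => /=; rewrite !inE /=.
    by case: eqP => [->|_]; rewrite ?orbF ?orbT.
  case: (f =P e) => [->|/eqP fe] /=; first by rewrite orbT.
  case xf: (x \in sval f) => //=; rewrite /line_adj eq_sym fe.
  by apply/esym/set0Pn; exists x; rewrite inE xe.
rewrite cardsX cards1 muln1; case: (Phi); first exact: card_edges_at.
exact: (@card_cl_nbhd (line_graph G)).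
Qed.

End PhiSumEdges.

Lemma evdeg_edge_edge (G H : sgraph) (e f : edge G) (y : H) : line_adj e f ->
  evdeg [set ((inr e, y) : phi_sum ESTo G H); (inr f, y)]
  = evdeg [set (e : line_graph G); f] + 3.
Proof.
move=> ef; rewrite [LHS]evdeg_set2 card_sumX addnC; congr (_ + _).
  rewrite evdeg_set2 -[RHS]muln1 -(cards1 y) -cardsX.
  apply: eq_card => -[g u]; rewrite !inE /= !(@sum_adjE ESTo G H) (eq_sym y) /=.
  by case: (u == y); rewrite ?andbF ?andbT.
rewrite -(card_adjacent_edges ef) -[RHS]muln1 -(cards1 y) -cardsX.
apply: eq_card => -[x u]; rewrite !inE /= !(@sum_adjE ESTo G H) (eq_sym y).
by case: (u == y); rewrite ?andbF ?andbT.
Qed.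

(** * The edges of G +_Phi H by type *)

Lemma sum_prod (I J : finType) (P : pred (I * J)) (F : I * J -> nat) :
  \sum_(p | P p) F p = \sum_i \sum_(j | P (i, j)) F (i, j).
Proof. by rewrite pair_big_dep; apply: eq_big => -[]. Qed.

Lemma sum_diag (I : finType) (b : bool) (F : I -> I -> nat) :
  \sum_i \sum_(j | (i == j) && b) F i j = if b then \sum_i F i i else 0.
Proof.
case: b; last by apply: big1 => i _; apply: big1 => j; rewrite andbF.
apply: eq_bigr => i _; rewrite (eq_bigl (pred1 i)) ?big_pred1_eq // => j.
by rewrite andbT eq_sym.
Qed.

(** The factor 2 comes from the incidences, which give one dart in each
    direction; in the other two families the index set already consists of
    darts. *)
Lemma sum_darts_phi_sum (Phi : transform) (G H : sgraph)
    (F : {set phi_sum Phi G H} -> nat) :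
  \sum_(p : phi_sum Phi G H * phi_sum Phi G H | adj p.1 p.2) F [set p.1; p.2]
  = \sum_(x : G) \sum_(q : H * H | adj q.1 q.2) F [set (inl x, q.1); (inl x, q.2)]
    + 2 * \sum_(i : G * edge G | i.1 \in val i.2) \sum_(y : H)
            F [set (inl i.1, y); (inr i.2, y)]
    + \sum_(p : edge G * edge G | transform_adj Phi (inr p.1) (inr p.2))
        \sum_(y : H) F [set (inr p.1, y); (inr p.2, y)].
Proof.
(* Contribution of the darts from the fibre of u to the fibre of v. *)
pose D (u v : G + edge G) : nat :=
  \sum_(y : H) \sum_(z : H | @phi_sum_adj Phi G H (u, y) (v, z)) F [set (u, y); (v, z)].
have DXX x x' : D (inl x) (inl x') =
    if x == x' then \sum_(q : H * H | adj q.1 q.2) F [set (inl x, q.1); (inl x, q.2)]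
    else 0.
  rewrite sum_prod /D; case: (x =P x') => [<-|/eqP/negbTE neq].
    by apply: eq_bigr => y _; apply: eq_bigl => z; rewrite adj_vertex_vertex eqxx.
  by apply: big1 => y _; apply: big1 => z; rewrite adj_vertex_vertex neq.
have DXE x e : D (inl x) (inr e) =
    if x \in val e then \sum_(y : H) F [set (inl x, y); (inr e, y)] else 0.
  rewrite -(sum_diag (x \in val e)
    (fun y z => F [set ((inl x, y) : phi_sum Phi G H); (inr e, z)])).
  apply: eq_bigr => y _.
  by apply: eq_bigl => z; rewrite adj_vertex_edge.
have DEX x e : D (inr e) (inl x) =
    if x \in val e then \sum_(y : H) F [set (inl x, y); (inr e, y)] else 0.
  rewrite -(sum_diag (x \in val e)
    (fun y z => F [set ((inl x, y) : phi_sum Phi G H); (inr e, z)])).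
  apply: eq_bigr => y _.
  apply: eq_big => z; rewrite adj_edge_vertex // => /andP[/eqP-> _].
  by rewrite setUC.
have DEE e f : D (inr e) (inr f) =
    if transform_adj Phi (inr e) (inr f)
    then \sum_(y : H) F [set (inr e, y); (inr f, y)] else 0.
  rewrite -(sum_diag (transform_adj Phi (inr e) (inr f))
    (fun y z => F [set ((inr e, y) : phi_sum Phi G H); (inr f, z)])).
  apply: eq_bigr => y _.
  by apply: eq_bigl => z; rewrite adj_edge_edge.
transitivity (\sum_u \sum_v D u v).
  rewrite !sum_prod; apply: eq_bigr => u _ /=.
  rewrite exchange_big; apply: eq_bigr => y _ /=.
  by rewrite sum_prod.
rewrite big_sumType /= mulSn mul1n.
under eq_bigr do rewrite big_sumType /=.
under [X in _ + X]eq_bigr do rewrite big_sumType /=.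
rewrite !big_split /= [X in _ + (X + _) = _]exchange_big /= !addnA.
congr (_ + _ + _ + _).
- apply: eq_bigr => x _; rewrite (bigD1 x) //= DXX eqxx [X in _ + X]big1 ?addn0 // => x'.
  by rewrite DXX eq_sym => /negbTE->.
- rewrite sum_prod; apply: eq_bigr => x _; rewrite [RHS]big_mkcond /=.
  by apply: eq_bigr.
- rewrite sum_prod; apply: eq_bigr => x _; rewrite [RHS]big_mkcond /=.
  by apply: eq_bigr.
- rewrite sum_prod; apply: eq_bigr => e _; rewrite [RHS]big_mkcond /=.
  by apply: eq_bigr.
Qed.

(** * The three contributions *)

(** The mixed term of the squares is 8 m(G) times the sum of the ev-degrees over
    the darts of H, whence the triangles of H. *)
Lemma sum_vertex_vertex (Phi : transform) (G H : sgraph) :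
  \sum_(x : G) \sum_(q : H * H | adj q.1 q.2)
     evdeg [set ((inl x, q.1) : phi_sum Phi G H); (inl x, q.2)] ^ 2
  + 48 * (nedge G * ntriangles H)
  = 2 * (nvert G * evZagreb H) + 8 * (nedge H * firstZagreb G)
    + 16 * (nedge G * firstZagreb H).
Proof.
under eq_bigr do under eq_bigr do rewrite evdeg_vertex_vertex //.
rewrite (sum_sqrD xpredT (fun q : H * H => adj q.1 q.2)
  (fun x : G => 2 * deg x) (fun q => evdeg [set q.1; q.2])).
have H1 := sum_evdeg H; have H2 := double_evZagreb H.
rewrite card_darts H2 -big_distrr /= handshake.
rewrite (eq_bigr (fun x : G => 4 * deg x ^ 2)); last by move=> x _; ring.
rewrite -big_distrr /= -/(firstZagreb G) sum1_card -/(nvert G).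
move: H1; set s := \sum_(p | _) _ => H1.
have -> : 48 * (nedge G * ntriangles H) = 8 * nedge G * (6 * ntriangles H) by ring.
have -> : 16 * (nedge G * firstZagreb H) = 8 * nedge G * (2 * firstZagreb H) by ring.
rewrite -H1; ring.
Qed.

Lemma sum_vertex_edge_Sd (G H : sgraph) :
  \sum_(i : G * edge G | i.1 \in val i.2) \sum_(y : H)
     evdeg [set ((inl i.1, y) : phi_sum Sd G H); (inr i.2, y)] ^ 2
  = nvert H * forgotten G + 4 * (nedge H * firstZagreb G)
    + 4 * (nvert H * firstZagreb G) + 2 * (nedge G * firstZagreb H)
    + 16 * (nedge G * nedge H) + 8 * (nvert H * nedge G).
Proof.
transitivity (\sum_(i : G * edge G | i.1 \in val i.2) \sum_(y : H)
    ((deg i.1 + 2) + deg y) ^ 2).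
  apply: eq_bigr => i xi; apply: eq_bigr => y _.
  by rewrite evdeg_vertex_edge //; congr (_ ^ 2); ring.
rewrite (sum_sqrD (fun i : G * edge G => i.1 \in val i.2) xpredT
  (fun i => deg i.1 + 2) (fun y : H => deg y)).
rewrite card_incidences handshake -/(firstZagreb H) sum1_card -/(nvert H).
rewrite (sum_incidences_vertex (fun x => deg x + 2)).
rewrite (sum_incidences_vertex (fun x => (deg x + 2) ^ 2)).
have -> : \sum_(x : G) deg x * (deg x + 2) = firstZagreb G + 4 * nedge G.
  rewrite (eq_bigr (fun x : G => deg x ^ 2 + 2 * deg x)); last by move=> x _; ring.
  rewrite big_split -big_distrr /= handshake -/(firstZagreb G); ring.
have -> : \sum_(x : G) deg x * (deg x + 2) ^ 2
    = forgotten G + 4 * firstZagreb G + 8 * nedge G.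
  rewrite (eq_bigr (fun x : G => deg x ^ 3 + 4 * deg x ^ 2 + 4 * deg x));
    last by move=> x _; ring.
  rewrite 2!big_split -!big_distrr /= handshake -/(firstZagreb G) -/(forgotten G).
  ring.
ring.
Qed.

Lemma sum_vertex_edge_ESTo (G H : sgraph) :
  \sum_(i : G * edge G | i.1 \in val i.2) \sum_(y : H)
     evdeg [set ((inl i.1, y) : phi_sum ESTo G H); (inr i.2, y)] ^ 2
  = 2 * (nedge G * firstZagreb H) + 18 * (nedge G * nvert H)
    + 2 * (nvert H * firstZagreb (line_graph G)) + 24 * (nedge G * nedge H)
    + 16 * (nedge (line_graph G) * nedge H) + 24 * (nvert H * nedge (line_graph G)).
Proof.
transitivity (\sum_(i : G * edge G | i.1 \in val i.2) \sum_(y : H)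
    ((deg (i.2 : line_graph G) + 3) + deg y) ^ 2).
  apply: eq_bigr => i xi; apply: eq_bigr => y _.
  by rewrite evdeg_vertex_edge //; congr (_ ^ 2); ring.
rewrite (sum_sqrD (fun i : G * edge G => i.1 \in val i.2) xpredT
  (fun i => deg (i.2 : line_graph G) + 3) (fun y : H => deg y)).
rewrite card_incidences handshake -/(firstZagreb H) sum1_card -/(nvert H).
rewrite (sum_incidences_edge (fun e : line_graph G => deg e + 3)).
rewrite (sum_incidences_edge (fun e : line_graph G => (deg e + 3) ^ 2)).
have -> : \sum_(e : line_graph G) (deg e + 3) = 2 * nedge (line_graph G) + 3 * nedge G.
  rewrite big_split /= (handshake (line_graph G)) sum_nat_const.
  by rewrite nvert_line_graph [3 * _]mulnC.
have -> : \sum_(e : line_graph G) (deg e + 3) ^ 2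
    = firstZagreb (line_graph G) + 12 * nedge (line_graph G) + 9 * nedge G.
  rewrite (eq_bigr (fun e : line_graph G => deg e ^ 2 + 6 * deg e + 9));
    last by move=> x _; ring.
  rewrite 2!big_split -!big_distrr /= (handshake (line_graph G)).
  rewrite -/(firstZagreb (line_graph G)).
  rewrite sum_nat_const nvert_line_graph; ring.
ring.
Qed.

(** Summing (deg^ev + 3)^2 over the darts of L(G), the mixed term brings in the
    triangles of L(G). *)
Lemma sum_edge_edge (G H : sgraph) :
  \sum_(p : edge G * edge G | line_adj p.1 p.2) \sum_(y : H)
     evdeg [set ((inr p.1, y) : phi_sum ESTo G H); (inr p.2, y)] ^ 2
  + 36 * (nvert H * ntriangles (line_graph G))
  = 2 * (nvert H * evZagreb (line_graph G))
    + 12 * (nvert H * firstZagreb (line_graph G))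
    + 18 * (nvert H * nedge (line_graph G)).
Proof.
pose L := line_graph G.
transitivity (nvert H * \sum_(p : L * L | adj p.1 p.2)
    (evdeg [set p.1; p.2] ^ 2 + 6 * evdeg [set p.1; p.2] + 9)
  + 36 * (nvert H * ntriangles L)).
  congr (_ + _); rewrite big_distrr /=; apply: eq_bigr => p ef.
  under eq_bigr do rewrite evdeg_edge_edge //.
  rewrite sum_nat_const -/(nvert H); congr (_ * _); ring.
have H1 := sum_evdeg L; have H2 := double_evZagreb L.
rewrite 2!big_split /= H2 -big_distrr /=.
have -> : \sum_(p : L * L | adj p.1 p.2) 9 = 9 * (2 * nedge L).
  by rewrite -card_darts big_distrr.
move: H1; set s := \sum_(p | _) _ => H1.
have -> : 36 * (nvert H * ntriangles L) = 6 * nvert H * (6 * ntriangles L) by ring.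
have -> : 12 * (nvert H * firstZagreb L) = 6 * nvert H * (2 * firstZagreb L) by ring.
rewrite -H1; ring.
Qed.

(** * The ev-degree Zagreb index of G +_Phi H *)

Import GRing.Theory.
Local Open Scope ring_scope.

Theorem theorem4p1 (G H : sgraph)
    (hG : connected_graph G) (hH : connected_graph H) :
  (evZagreb (phi_sum Sd G H))%:Z
    = (nvert G)%:Z * (evZagreb H)%:Z
      + (nvert H)%:Z * (forgotten G)%:Z
      + 8 * (nedge H)%:Z * (firstZagreb G)%:Z
      + 4 * (nvert H)%:Z * (firstZagreb G)%:Z
      + 10 * (nedge G)%:Z * (firstZagreb H)%:Z
      + 16 * (nedge G)%:Z * (nedge H)%:Z
      + 8 * (nvert H)%:Z * (nedge G)%:Z
      - 24 * (ntriangles H)%:Z * (nedge G)%:Z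
  /\
  (evZagreb (phi_sum ESTo G H))%:Z
    = (nvert H)%:Z * (evZagreb (line_graph G))%:Z
      + (nvert G)%:Z * (evZagreb H)%:Z
      + 8 * (nvert H)%:Z * (firstZagreb (line_graph G))%:Z
      + 4 * (nedge H)%:Z * (firstZagreb G)%:Z
      + 10 * (nedge G)%:Z * (firstZagreb H)%:Z
      + 33 * (nvert H)%:Z * (nedge (line_graph G))%:Z
      + 16 * (nedge (line_graph G))%:Z * (nedge H)%:Z
      + 24 * (nedge G)%:Z * (nedge H)%:Z
      + 18 * (nedge G)%:Z * (nvert H)%:Z
      - 24 * (nedge G)%:Z * (ntriangles H)%:Z
      - 18 * (nvert H)%:Z * (ntriangles (line_graph G))%:Z.
Proof.
split.
  have := double_evZagreb (phi_sum Sd G H).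
  rewrite (sum_darts_phi_sum (fun s => (evdeg s ^ 2)%N)).
  (* Distinct edges of G are never adjacent in Sd(G). *)
  rewrite sum_vertex_edge_Sd [X in (_ + X)%N]big_pred0 //.
  move: (sum_vertex_vertex Sd G H); move: (\sum_x _)%N => s.
  lia.
have := double_evZagreb (phi_sum ESTo G H).
rewrite (sum_darts_phi_sum (fun s => (evdeg s ^ 2)%N)) sum_vertex_edge_ESTo.
move: (sum_vertex_vertex ESTo G H) (sum_edge_edge G H).
move: (\sum_(p | _) _)%N (\sum_x _)%N => s t.
lia.
Qed.
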